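(* Let $D$ be a generalized inductive definition over a vocabulary $\Sigma$, and let $\Sigma' = \Sigma \cup \{P^{\neg} \mid P \text{ a defined predicate of } D\}$. Then there exists a one-to-one mapping between the $\Sigma$-models $I$ of $D$ and the $\Sigma'$-models $I'$ of the fixpoint definition $\Delta_D$ such that the domain of $I$ is the same as that of $I'$, the restriction of $I'$ to $\Sigma$ equals $I$, and $(P^{\neg})^{I'}$ is the (relative) complement of $P^I$ for each defined predicate $P$ of $D$.
   Context: A generalized inductive definition (GID) $D$ over $\Sigma$ is a finite set of rules $\forall \bar x (P(\bar x) \leftarrow \varphi[\bar x])$ with $\varphi$ an arbitrary first-order formula (defined predicates may occur negatively); w.l.o.g. each defined predicate $P$ has exactly one rule $\forall \bar x (P(\bar x) \leftarrow \varphi_P[\bar x])$. A model of a GID is a two-valued well-founded model of it (the semantics of FO(ID)). The translation: for each defined predicate $P$ of $D$ introduce a new predicate symbol $P^{\neg}$ of the same arity. For a formula $\varphi$, let $\overline{\varphi}$ be obtained by replacing each negative occurrence $P(\bar t)$ of a defined predicate $P$ by $\neg P^{\neg}(\bar t)$. Let $\mathcal{R}_D = \{\forall \bar x (P(\bar x) \leftarrow \overline{\varphi_P[\bar x]})\}$ and $\mathcal{R}^{\neg}_D = \{\forall \bar x (P^{\neg}(\bar x) \leftarrow \overline{\neg\varphi_P[\bar x]})\}$, ranging over the defined predicates $P$ of $D$. Then $\Delta_D$ is the least fixpoint definition whose local rules are $\mathcal{R}_D$ and which has as its single subdefinition the greatest fixpoint definition with rules $\mathcal{R}^{\neg}_D$.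 Semantics of fixpoint definitions: for a rule set $\mathcal{R}$ and an interpretation $I$ of the open symbols, the operator maps an interpretation $J$ of the defined predicates to $K$ with $P^K = \{\bar d \mid (I+J)[\bar x/\bar d] \models \varphi_P[\bar x]\}$; for a nested definition, the operator first computes, for each subdefinition, its least (for an LFD) or greatest (for a GFD) fixpoint given the open symbols plus the current values of the locally defined predicates, then applies the local rules. An interpretation is a model of an LFD (resp. GFD) iff its restriction to the defined predicates equals the least (resp. greatest) fixpoint of this operator given its restriction to the open symbols.
   Formalization: The mapping is injective into the models of Δ_D and onto only those models I' in which each P^¬ is the complement of P; a bijection onto all models of Δ_D fails, e.g. for D = {P ← ¬P}, where Δ_D has the model P = P^¬ = false but D has none. *)

(* Defs.v *)
From mathcomp Require Import all_boot finmap.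
From Stdlib Require Import ClassicalEpsilon.

Set Implicit Arguments.
Unset Strict Implicit.
Unset Printing Implicit Defensive.

Local Open Scope fset_scope.

Record signature := Signature { sym :> choiceType; arity : sym -> nat }.

Record vocabulary := Vocabulary { funs : signature; preds : signature }.

(* [term S n] and [formula S n] have their free variables among 'I_n.  Under a
   quantifier the bound variable is [ord0] and the others are shifted by 1. *)
Inductive term (F : signature) (n : nat) : Type :=
| Var of 'I_n
| App (f : F) of ('I_(arity f) -> term F n).

Inductive formula (S : vocabulary) (n : nat) : Type :=
| Atom (p : preds S) of ('I_(arity p) -> term (funs S) n)
| Equal of term (funs S) n & term (funs S) n
| Not of formula S n
| And of formula S n & formula S n
| Or of formula S n & formula S n
| All of formula S n.+1
| Ex of formula S n.+1.

Arguments Var {F n}.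
Arguments App {F n}.
Arguments Atom {S n}.
Arguments Equal {S n}.

Definition fun_interp (F : signature) (A : Type) :=
  forall f : F, ('I_(arity f) -> A) -> A.

Definition pred_interp (P : signature) (A : Type) :=
  forall p : P, ('I_(arity p) -> A) -> Prop.

Record structure (S : vocabulary) := Structure {
  dom : Type;
  dom_inhabited : inhabited dom;
  ifun : fun_interp (funs S) dom;
  ipred : pred_interp (preds S) dom }.

Arguments ifun {S} s f _.
Arguments ipred {S} s p _.

Definition env_cons (A : Type) (n : nat) (d : A) (e : 'I_n -> A) : 'I_n.+1 -> A :=
  fun i => if unlift ord0 i is Some j then e j else d.

Fixpoint eval (F : signature) (A : Type) (fi : fun_interp F A) (n : nat)
    (e : 'I_n -> A) (t : term F n) : A :=
  match t with
  | Var i => e i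
  | App f ts => fi f (fun i => eval fi e (ts i))
  end.

Fixpoint holds (S : vocabulary) (A : Type) (fi : fun_interp (funs S) A)
    (I : pred_interp (preds S) A) (n : nat) (phi : formula S n) (e : 'I_n -> A)
    : Prop :=
  match phi with
  | Atom p ts => I p (fun i => eval fi e (ts i))
  | Equal t u => eval fi e t = eval fi e u
  | Not psi => ~ holds fi I psi e
  | And psi chi => holds fi I psi e /\ holds fi I chi e
  | Or psi chi => holds fi I psi e \/ holds fi I chi e
  | All psi => forall d, holds fi I psi (env_cons d e)
  | Ex psi => exists d, holds fi I psi (env_cons d e)
  end.

(* A finite set of rules  forall x (p(x) <- body p [x]),  exactly one for each
   predicate in [heads]; the variables x are the 'I_(arity p).  A generalized
   inductive definition is such a set, read by [gid_model]. *)
Record rules (S : vocabulary) := Rules {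
  heads : {fset preds S};
  body : forall p, p \in heads -> formula S (arity p) }.

(* Interpretations of a subset X of the predicate symbols are represented by
   interpretations of all symbols: [override X J I] takes the symbols of X from
   J and all others from I. *)
Definition override (P : signature) (A : Type) (X : {fset P})
    (J I : pred_interp P A) : pred_interp P A :=
  fun p => if p \in X then J p else I p.

Definition sub_interp (P : signature) (A : Type) (I J : pred_interp P A) : Prop :=
  forall p args, I p args -> J p args.

Variant fp_kind := Least | Greatest.

Definition is_fp (P : signature) (A : Type) (k : fp_kind)
    (G : pred_interp P A -> pred_interp P A) (J : pred_interp P A) : Prop :=
  G J = J /\
  forall K, G K = K ->
    match k with Least => sub_interp J K | Greatest => sub_interp K J end.

(* Fixpoint definitions, possibly nested: LFDs ([Least]) and GFDs ([Greatest])
   given by their local rules and their subdefinitions. *)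
Inductive fixdef (S : vocabulary) : Type :=
| FixDef of fp_kind & rules S & seq (fixdef S).

Definition kind_of (S : vocabulary) (D : fixdef S) : fp_kind :=
  let: FixDef k _ _ := D in k.

Fixpoint defined (S : vocabulary) (D : fixdef S) : {fset preds S} :=
  let: FixDef _ R subs := D in
  heads R `|` foldr (fun D' X => defined D' `|` X) fset0 subs.

Definition conseq (S : vocabulary) (A : Type) (fi : fun_interp (funs S) A)
    (R : rules S) (I : pred_interp (preds S) A) : pred_interp (preds S) A :=
  fun p args => exists hp : p \in heads R, holds fi I (body hp) args.

(* The operator of a fixpoint definition.  The result agrees with [I] on the
   open symbols, and (as long as no subdefinition mentions a symbol defined in
   another one) the values of [I] on the defined symbols are not used, so the
   fixpoints of [fd_op fi D I] are the expansions of the open part of [I] by the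
   fixpoints of the operator on interpretations of the defined symbols.
   [epsilon] picks the least, resp. greatest, fixpoint of a subdefinition. *)
Fixpoint fd_op (S : vocabulary) (A : Type) (fi : fun_interp (funs S) A)
    (D : fixdef S) (I J : pred_interp (preds S) A) : pred_interp (preds S) A :=
  let: FixDef _ R subs := D in
  let base := override (heads R) J I in
  let ext := foldr (fun D' K =>
      override (defined D')
        (epsilon (inhabits base) (is_fp (kind_of D') (fd_op fi D' base))) K)
    base subs in
  override (heads R) (conseq fi R ext) ext.

Definition fd_model (S : vocabulary) (D : fixdef S) (I : structure S) : Prop :=
  is_fp (kind_of D) (fd_op (ifun I) D (ipred I)) (ipred I).

(* Truth in a pair of interpretations: positive occurrences of predicates are
   read in [I], negative ones in [J].  For three-valued interpretations
   represented as pairs (L, U) (L: what is true, U: what is not false), Kleene's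
   valuation makes phi true iff [holds2 L U phi], and not false iff
   [holds2 U L phi]. *)
Fixpoint holds2 (S : vocabulary) (A : Type) (fi : fun_interp (funs S) A)
    (I J : pred_interp (preds S) A) (n : nat) (phi : formula S n) (e : 'I_n -> A)
    : Prop :=
  match phi with
  | Atom p ts => I p (fun i => eval fi e (ts i))
  | Equal t u => eval fi e t = eval fi e u
  | Not psi => ~ holds2 fi J I psi e
  | And psi chi => holds2 fi I J psi e /\ holds2 fi I J chi e
  | Or psi chi => holds2 fi I J psi e \/ holds2 fi I J chi e
  | All psi => forall d, holds2 fi I J psi (env_cons d e)
  | Ex psi => exists d, holds2 fi I J psi (env_cons d e)
  end.

Definition gid_conseq (S : vocabulary) (A : Type) (fi : fun_interp (funs S) A)
    (D : rules S) (O I J : pred_interp (preds S) A) : pred_interp (preds S) A :=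
  override (heads D)
    (fun p args => exists hp : p \in heads D,
       holds2 fi (override (heads D) I O) (override (heads D) J O) (body hp) args)
    O.

(* With ST(J) the least fixpoint of [gid_conseq fi D O ^~ J], this says that
   (L, U) is a fixpoint of the stable operator (L, U) |-> (ST(U), ST(L)). *)
Definition partial_stable (S : vocabulary) (A : Type)
    (fi : fun_interp (funs S) A) (D : rules S) (O L U : pred_interp (preds S) A)
    : Prop :=
  is_fp Least (fun I => gid_conseq fi D O I U) L /\
  is_fp Least (fun I => gid_conseq fi D O I L) U.

(* The well-founded model of D extending the open part of [O]: the fixpoint of
   the stable operator that is least in the precision order. *)
Definition well_founded (S : vocabulary) (A : Type) (fi : fun_interp (funs S) A)
    (D : rules S) (O L U : pred_interp (preds S) A) : Prop :=
  partial_stable fi D O L U /\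
  forall L' U', partial_stable fi D O L' U' -> sub_interp L L' /\ sub_interp U' U.

Definition gid_model (S : vocabulary) (D : rules S) (I : structure S) : Prop :=
  well_founded (ifun I) D (ipred I) (ipred I) (ipred I).

Section Translation.
Variables (S : vocabulary) (D : rules S).

(* [inl p] is the symbol p of S, and [inr p] is the new symbol p^neg. *)
Definition ext_preds : signature :=
  @Signature (sym (preds S) + heads D)%type
    (fun q => match q with inl p => arity p | inr u => arity (val u) end).

Definition ext_voc : vocabulary := Vocabulary (funs S) ext_preds.

Definition old_sym (p : preds S) : preds ext_voc := inl p.
Definition neg_sym (p : preds S) (hp : p \in heads D) : preds ext_voc :=
  inr (FSetSub hp).

(* [pos] tells whether [phi] itself stands at a positive position; the formula
   written with a bar in the source is [bar true phi]. *)
Fixpoint bar (pos : bool) (n : nat) (phi : formula S n) : formula ext_voc n :=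
  match phi with
  | Atom p ts =>
      match decP (@idP (p \in heads D)) with
      | left hp =>
          if pos then @Atom ext_voc n (old_sym p) ts
          else Not (@Atom ext_voc n (neg_sym hp) ts)
      | right _ => @Atom ext_voc n (old_sym p) ts
      end
  | Equal t u => @Equal ext_voc n t u
  | Not psi => Not (bar (~~ pos) psi)
  | And psi chi => And (bar pos psi) (bar pos chi)
  | Or psi chi => Or (bar pos psi) (bar pos chi)
  | All psi => All (bar pos psi)
  | Ex psi => Ex (bar pos psi)
  end.

Definition pos_heads : {fset preds ext_voc} := [fset old_sym p | p in heads D].

Definition neg_heads : {fset preds ext_voc} :=
  [fset (inr u : preds ext_voc) | u in {: heads D}].

Lemma old_sym_pos (p : preds S) : old_sym p \in pos_heads -> p \in heads D.
Proof. by case/imfsetP=> q hq [->]. Qed.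

Lemma neg_sym_pos (u : heads D) : (inr u : preds ext_voc) \notin pos_heads.
Proof. by apply/imfsetP=> -[]. Qed.

Lemma old_sym_neg (p : preds S) : old_sym p \notin neg_heads.
Proof. by apply/imfsetP=> -[]. Qed.

Definition pos_body (q : preds ext_voc) : q \in pos_heads -> formula ext_voc (arity q) :=
  match q with
  | inl p => fun hq => bar true (body (old_sym_pos hq))
  | inr u => fun hq => False_rect _ (negP (neg_sym_pos u) hq)
  end.

Definition neg_body (q : preds ext_voc) : q \in neg_heads -> formula ext_voc (arity q) :=
  match q with
  | inl p => fun hq => False_rect _ (negP (old_sym_neg p) hq)
  | inr u => fun _ => bar true (Not (body (valP u)))
  end.

Definition pos_rules : rules ext_voc := Rules pos_body.
Definition neg_rules : rules ext_voc := Rules neg_body.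

Definition Delta : fixdef ext_voc :=
  FixDef Least pos_rules [:: FixDef Greatest neg_rules [::]].

Definition restrict (I : structure ext_voc) : structure S :=
  @Structure S (dom I) (dom_inhabited I) (ifun I) (fun p => ipred I (old_sym p)).

Definition complementary (I : structure ext_voc) : Prop :=
  forall (p : preds S) (hp : p \in heads D) (args : 'I_(arity p) -> dom I),
    ipred I (neg_sym hp) args <-> ~ ipred (restrict I) p args.

End Translation.

(* Main.v *)
Require Import Defs.
From mathcomp Require Import all_boot finmap.
From Stdlib Require Import Classical ClassicalEpsilon FunctionalExtensionality.
From Stdlib Require Import PropExtensionality ProofIrrelevance.

(** Write [T(I, J)] for one application of the rules of [D] that reads positive
    occurrences of defined predicates in [I] and negative ones in [J]; it is
    monotone in [I] and antitone in [J].  Let [ST(J)] be the least fixpoint of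
    [T(-, J)].  Up to complementation the inner greatest fixpoint definition
    computes [ST(J)] from the value [J] of the original defined predicates, so
    the outer operator is [J |-> T(J, ST(J))].  Its least fixpoint is also the
    least fixpoint of [ST o ST], that is, the lower half of the well-founded
    model; the new predicates then hold the complement of the upper half
    [ST(J)].  They are complementary to the old ones iff the well-founded model
    is two-valued. *)

Set Implicit Arguments.
Unset Strict Implicit.

Local Open Scope fset_scope.

(** * Interpretations ordered by inclusion, and their least fixpoints *)

Lemma pred_interp_ext (P : signature) (A : Type) (I J : pred_interp P A) :
  (forall p args, I p args <-> J p args) -> I = J.
Proof.
move=> IJ; apply: functional_extensionality_dep => p.
apply: functional_extensionality => args.
exact: propositional_extensionality.
Qed.

Lemma sub_interp_anti (P : signature) (A : Type) (I J : pred_interp P A) :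
  sub_interp I J -> sub_interp J I -> I = J.
Proof.
by move=> IJ JI; apply: pred_interp_ext => p args; split; [apply: IJ|apply: JI].
Qed.

Lemma is_fp_unique (P : signature) (A : Type) (k : fp_kind)
    (G : pred_interp P A -> pred_interp P A) (I J : pred_interp P A) :
  is_fp k G I -> is_fp k G J -> I = J.
Proof.
case=> GI minI [GJ minJ]; case: k minI minJ => minI minJ;
  by apply: sub_interp_anti; auto.
Qed.

Definition lfp (P : signature) (A : Type)
    (G : pred_interp P A -> pred_interp P A) : pred_interp P A :=
  fun p args => forall I, sub_interp (G I) I -> I p args.

Section KnasterTarski.
Variables (P : signature) (A : Type) (G : pred_interp P A -> pred_interp P A).
Hypothesis G_mono : forall I J, sub_interp I J -> sub_interp (G I) (G J).

Lemma lfp_le (I : pred_interp P A) : sub_interp (G I) I -> sub_interp (lfp G) I.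
Proof. by move=> GI p args; apply. Qed.

Lemma lfp_fixed : G (lfp G) = lfp G.
Proof.
have pre : sub_interp (G (lfp G)) (lfp G).
  move=> p args h I GI; apply: (GI); move: h; apply: G_mono; exact: lfp_le.
by apply: sub_interp_anti => //; apply: lfp_le; apply: G_mono.
Qed.

Lemma is_fp_lfp : is_fp Least G (lfp G).
Proof. by split=> [|K GK]; [exact: lfp_fixed|apply: lfp_le; rewrite GK]. Qed.

End KnasterTarski.

Lemma holds2_mono (S : vocabulary) (A : Type) (fi : fun_interp (funs S) A)
    (I I' J J' : pred_interp (preds S) A) (n : nat) (phi : formula S n)
    (e : 'I_n -> A) :
  sub_interp I I' -> sub_interp J' J ->
  holds2 fi I J phi e -> holds2 fi I' J' phi e.
Proof.
elim: phi I I' J J' e => {n} [n p ts|n t u|n f IH|n f IHf g IHg|n f IHf g IHg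
  |n f IH|n f IH] I I' J J' e II JJ /=.
- exact: II.
- by [].
- by move=> h h'; apply: h; apply: IH h'.
- by case=> hf hg; split; [apply: IHf hf|apply: IHg hg].
- by case=> [hf|hg]; [left; apply: IHf hf|right; apply: IHg hg].
- by move=> h d; apply: IH (h d).
- by case=> d h; exists d; apply: IH h.
Qed.

Lemma override_mono (P : signature) (A : Type) (X : {fset P})
    (I J O : pred_interp P A) :
  sub_interp I J -> sub_interp (override X I O) (override X J O).
Proof. by move=> IJ p args; rewrite /override; case: ifP => // _; apply: IJ. Qed.

Lemma overrideK (P : signature) (A : Type) (X : {fset P})
    (I J O : pred_interp P A) :
  override X I (override X J O) = override X I O.
Proof.
apply: functional_extensionality_dep => p.
by rewrite /override; case: (p \in X).
Qed.

Lemma override_in (P : signature) (A : Type) (X : {fset P})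
    (I J : pred_interp P A) p : p \in X -> @override P A X I J p = I p.
Proof. by rewrite /override => ->. Qed.

Lemma override_notin (P : signature) (A : Type) (X : {fset P})
    (I J : pred_interp P A) p : p \notin X -> @override P A X I J p = J p.
Proof. by rewrite /override => /negbTE ->. Qed.

(** * The stable operator and two-valued well-founded models *)

Section StableOperator.
Variables (S : vocabulary) (A : Type) (fi : fun_interp (funs S) A).
Variables (D : rules S) (O : pred_interp (preds S) A).

Local Notation T := (gid_conseq fi D O).

Definition stable (J : pred_interp (preds S) A) : pred_interp (preds S) A :=
  lfp (fun I => T I J).

Lemma gid_conseq_head I J p (hp : p \in heads D) (args : 'I_(arity p) -> A) :
  T I J args <->
  holds2 fi (override (heads D) I O) (override (heads D) J O) (body hp) args.
Proof.
rewrite /gid_conseq override_in //; split=> [[hp']|h]; last by exists hp.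
by rewrite (bool_irrelevance hp' hp).
Qed.

Lemma gid_conseq_open I J p (args : 'I_(arity p) -> A) :
  p \notin heads D -> T I J args = O args.
Proof. by move=> hp; rewrite /gid_conseq override_notin. Qed.

Lemma gid_conseq_mono I I' J J' :
  sub_interp I I' -> sub_interp J' J -> sub_interp (T I J) (T I' J').
Proof.
move=> II JJ; apply: override_mono => p args [hp h]; exists hp.
by apply: holds2_mono h; apply: override_mono.
Qed.

Lemma stable_is_lfp J : is_fp Least (fun I => T I J) (stable J).
Proof. by apply: is_fp_lfp => I I' II; apply: gid_conseq_mono. Qed.

Lemma stable_fixed J : T (stable J) J = stable J.
Proof. by case: (stable_is_lfp J). Qed.

Lemma stable_unique I J : is_fp Least (fun I => T I J) I -> I = stable J.
Proof. by move=> h; apply: is_fp_unique h (stable_is_lfp J). Qed.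

Lemma stable_anti J J' : sub_interp J J' -> sub_interp (stable J') (stable J).
Proof.
move=> JJ; apply: lfp_le => p args.
by rewrite -{2}(stable_fixed J); apply: gid_conseq_mono.
Qed.

Definition alt_op (J : pred_interp (preds S) A) : pred_interp (preds S) A :=
  T J (stable J).

Lemma alt_op_mono I J : sub_interp I J -> sub_interp (alt_op I) (alt_op J).
Proof. by move=> IJ; apply: gid_conseq_mono => //; apply: stable_anti. Qed.

Lemma stable2_alt J : J = stable (stable J) -> alt_op J = J.
Proof. by move=> h; rewrite /alt_op {1 3}h stable_fixed. Qed.

(** As M = T(M, ST(M)), M is a pre-fixpoint of T(-, ST(M)), so M' = ST(ST(M)) lies in M. Then ST(M)
    lies in ST(M'), so T(M', ST(M')) lies in T(M', ST(M)) = M': M' is a pre-fixpoint of [alt_op] and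
    contains M. *)
Lemma alt_lfp_stable2 : lfp alt_op = stable (stable (lfp alt_op)).
Proof.
set M := lfp alt_op; set M' := stable (stable M).
have altM : alt_op M = M := lfp_fixed alt_op_mono.
have M'M : sub_interp M' M by apply: lfp_le; rewrite -/(alt_op M) altM.
have fixM' : T M' (stable M) = M' := stable_fixed _.
apply: sub_interp_anti => //; apply: lfp_le => p args h.
rewrite -fixM'; move: h.
by apply: gid_conseq_mono => //; apply: stable_anti.
Qed.

Lemma alt_lfp_partial_stable :
  partial_stable fi D O (lfp alt_op) (stable (lfp alt_op)).
Proof.
by split; [rewrite {2}alt_lfp_stable2|]; apply: stable_is_lfp.
Qed.

(** If (I, I) is well-founded, comparing it with the partial stable pair (M, ST(M)), where M =
    [lfp alt_op], puts I inside M, hence inside every fixpoint of [alt_op]. Conversely, a partial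
    stable pair (L, U) satisfies L = ST(ST(L)), so L is a fixpoint of [alt_op] and contains I;
    antitonicity then puts U = ST(L) inside ST(I) = I. *)
Lemma well_founded2P (I : pred_interp (preds S) A) :
  well_founded fi D O I I <-> stable I = I /\ is_fp Least alt_op I.
Proof.
split=> [[[stI _] minI]|[stI [altI minI]]].
- have {}stI : stable I = I by rewrite -(stable_unique stI).
  split=> //; split=> [|K altK].
    by rewrite /alt_op stI; move: (stable_fixed I); rewrite stI.
  move=> p args /(proj1 (minI _ _ alt_lfp_partial_stable)).
  by apply: lfp_le; rewrite altK.
- have lfpI : is_fp Least (fun I' => T I' I) I.
    by rewrite -{2}stI; apply: stable_is_lfp.
  split=> // L U [/stable_unique defL /stable_unique defU].
  have IL : sub_interp I L by apply: minI; apply: stable2_alt; rewrite -defU.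
  by split=> //; rewrite defU -stI; apply: stable_anti.
Qed.

End StableOperator.

(** * The translated rules and the operators of [Delta] *)

Section Translation.
Variables (S : vocabulary) (A : Type) (fi : fun_interp (funs S) A).
Variable D : rules S.

Local Notation H := (heads D).
Local Notation interp := (pred_interp (preds S) A).
Local Notation interp' := (pred_interp (preds (ext_voc D)) A).

(* The new predicates are interpreted by the complements of [N]. *)
Definition pair_interp (J N : interp) : interp' :=
  fun q => match q with
           | inl p => J p
           | inr u => fun args => ~ N (val u) args
           end.

Definition old_part (X : interp') : interp := fun p => X (old_sym D p).

(** The complement of the new predicates. Outside [H] it is true everywhere, a junk value, so
    [neg_part] is compared with other interpretations on [H] only. *)
Definition neg_part (X : interp') : interp :=
  fun p args => forall hp : p \in H, ~ X (neg_sym hp) args.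

Lemma neg_partE (X : interp') p (hp : p \in H) (args : 'I_(arity p) -> A) :
  neg_part X args <-> ~ X (neg_sym hp) args.
Proof.
split=> [h|h hp']; first exact: h.
by rewrite (bool_irrelevance hp' hp).
Qed.

Lemma pair_interpE (X : interp') : X = pair_interp (old_part X) (neg_part X).
Proof.
apply: pred_interp_ext => -[p|[p hp]] args //=.
rewrite (neg_partE X hp); split=> [h h'|/NNPP]; [exact: h'|exact].
Qed.

Lemma pair_interp_congr (J N N' : interp) :
  (forall p args, p \in H -> N p args <-> N' p args) ->
  pair_interp J N = pair_interp J N'.
Proof.
by move=> NN; apply: pred_interp_ext => -[p|u] args //=; rewrite (NN _ _ (valP u)).
Qed.

Lemma neg_part_pair (J N : interp) p (args : 'I_(arity p) -> A) :
  p \in H -> neg_part (pair_interp J N) args <-> N p args.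
Proof. by move=> hp; rewrite (neg_partE _ hp) /=; split=> [/NNPP|h h']. Qed.

(** A negative occurrence of a defined predicate becomes a negated new atom, that is, a double
    negation of [N]; open symbols stay in [J], whence [override H N J]. For [pos = false],
    occurrences positive in [phi] are negative in the whole formula, so the two readings are
    exchanged. *)
Lemma holds_bar (J N : interp) n (phi : formula S n) (pos : bool) e :
  holds (S := ext_voc D) fi (pair_interp J N) (bar D pos phi) e <->
  (if pos then holds2 fi J (override H N J) phi e
   else holds2 fi (override H N J) J phi e).
Proof.
elim: phi pos e => {n} [n p ts|n t u|n f IH|n f IHf g IHg|n f IHf g IHg
  |n f IH|n f IH] pos e /=.
- rewrite /override; case: (decP _) => [hp|/negP/negbTE hp] /=; case: pos => //=.
  + by rewrite hp; split=> [/NNPP|h h'].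
  + by rewrite hp.
- by case: pos.
- by rewrite IH; case: pos.
- by rewrite IHf IHg; case: pos.
- by rewrite IHf IHg; case: pos.
- by case: pos; split=> h d; move: (h d); rewrite IH.
- by case: pos; split=> -[d h]; exists d; move: h; rewrite IH.
Qed.

Lemma in_pos_heads p : (old_sym D p \in pos_heads D) = (p \in H).
Proof.
apply/idP/idP=> [|hp]; first exact: old_sym_pos.
by apply/imfsetP; exists p.
Qed.

Lemma in_neg_heads (u : H) : (inr u : preds (ext_voc D)) \in neg_heads D.
Proof. by apply/imfsetP; exists u. Qed.

Variable O : interp.
Local Notation T := (gid_conseq fi D O).

Lemma conseq_pos (J N : interp) p (args : 'I_(arity p) -> A) : p \in H ->
  conseq (S := ext_voc D) fi (pos_rules D) (pair_interp (override H J O) N)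
    (p := old_sym D p) args
  <-> T J N args.
Proof.
move=> hp; have hq : old_sym D p \in pos_heads D by rewrite in_pos_heads.
split=> [[hq']|].
- by rewrite holds_bar overrideK -gid_conseq_head.
- by move/gid_conseq_head=> h; exists hq; rewrite holds_bar overrideK; apply: h.
Qed.

(** The negation in front of the rule body puts the body itself at a negative position, which
    exchanges the roles of [J] and [N]. *)
Lemma conseq_neg (J N : interp) (u : H) (args : 'I_(arity (val u)) -> A) :
  conseq (S := ext_voc D) fi (neg_rules D) (pair_interp (override H J O) N)
    (p := inr u) args
  <-> ~ T N J args.
Proof.
rewrite (gid_conseq_head _ _ _ _ (valP u)); split=> [[hq] /=|h].
- by rewrite holds_bar overrideK.
- by exists (in_neg_heads u); rewrite /= holds_bar overrideK.
Qed.

Lemma override_pos (X Y : interp') : old_part Y = O ->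
  override (pos_heads D) X Y =
  pair_interp (override H (old_part X) O) (neg_part Y).
Proof.
move=> <-; apply: pred_interp_ext => -[p|u] args /=.
- by rewrite /override -in_pos_heads; case: ifP.
- rewrite /override (negbTE (neg_sym_pos u)).
  by rewrite {1}(pair_interpE Y).
Qed.

Lemma override_neg (X : interp') (J N : interp) :
  override (neg_heads D) X (pair_interp J N) = pair_interp J (neg_part X).
Proof.
apply: pred_interp_ext => -[p|u] args /=.
- by rewrite /override (negbTE (old_sym_neg D p)).
- by rewrite /override in_neg_heads {1}(pair_interpE X).
Qed.

Lemma neg_op (J N : interp) (K : interp') :
  fd_op (S := ext_voc D) fi (FixDef Greatest (neg_rules D) [::])
    (pair_interp (override H J O) N) K =
  pair_interp (override H J O) (T (neg_part K) J).
Proof.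
rewrite /= !override_neg.
apply: pred_interp_ext => -[p|[p hp]] args //=.
rewrite (neg_partE _ hp) conseq_neg; tauto.
Qed.

Lemma gid_conseq_congr (I I' J : interp) :
  (forall p args, p \in H -> I p args <-> I' p args) -> T I J = T I' J.
Proof.
move=> II; suff eqO : override H I O = override H I' O by rewrite /gid_conseq eqO.
apply: pred_interp_ext => p args; rewrite /override.
by case: ifP => // hp; apply: II.
Qed.

(** By [neg_op] the inner operator is T(-, J) seen through complements. Complementation reverses
    inclusion, so the least fixpoint ST(J) turns into the greatest one. *)
Lemma neg_gfp (J N : interp) :
  is_fp Greatest
    (fd_op (S := ext_voc D) fi (FixDef Greatest (neg_rules D) [::])
       (pair_interp (override H J O) N))
    (pair_interp (override H J O) (stable fi D O J)).
Proof.
split=> [|K].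
  rewrite neg_op -{2}(stable_fixed fi D O J); congr pair_interp.
  by apply: gid_conseq_congr => p args; apply: neg_part_pair.
rewrite neg_op => defK [p|u] args; first by rewrite -defK.
move=> Ku stu.
(* The complement of the new part of [K], filled with [O] outside [H], is a pre-fixpoint of T(-,
   J). *)
suff /(_ _ _ stu) : sub_interp (stable fi D O J) (override H (neg_part K) O).
  by case: u args Ku stu => p hp args Ku _; rewrite /override hp (neg_partE _ hp); apply.
apply: lfp_le => p {}args {u Ku stu}.
have -> : T (override H (neg_part K) O) J = T (neg_part K) J.
  by apply: gid_conseq_congr => q args' hq; rewrite override_in.
have [hp|hp] := boolP (p \in H); last by rewrite gid_conseq_open // override_notin.
by rewrite override_in // -{2}defK neg_part_pair.
Qed.

(** The subdefinition recomputes the new predicates, so only the old part of [K] influences the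
    result. *)
Lemma Delta_op (X K : interp') : old_part X = O ->
  fd_op (S := ext_voc D) fi (Delta D) X K =
  pair_interp (alt_op fi D O (old_part K)) (stable fi D O (old_part K)).
Proof.
move=> XO; set J := old_part K.
set B := override H J O; set st := stable fi D O J.
(* The greatest fixpoint exists by [neg_gfp] and is unique, which determines the choice made by
   [epsilon]. *)
have inner N : epsilon (inhabits (pair_interp B N))
    (is_fp Greatest (fd_op (S := ext_voc D) fi
      (FixDef Greatest (neg_rules D) [::]) (pair_interp B N))) = pair_interp B st.
  apply: is_fp_unique (neg_gfp J N).
  by apply: epsilon_spec; exists (pair_interp B st); apply: neg_gfp.
(* [base] and [ext] name the intermediate interpretations in the unfolding of [fd_op]; [fset0] comes
   from the empty list of subdefinitions inside the inner definition. *)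
pose base : interp' := override (pos_heads D) K X.
pose ext : interp' := override (neg_heads D `|` fset0)
  (epsilon (inhabits base) (is_fp Greatest (fd_op (S := ext_voc D) fi
    (FixDef Greatest (neg_rules D) [::]) base))) base.
change (override (pos_heads D) (conseq (S := ext_voc D) fi (pos_rules D) ext) ext
  = pair_interp (alt_op fi D O J) st).
have -> : ext = pair_interp B st.
  rewrite /ext /base fsetU0 override_pos // inner override_neg.
  by apply: pair_interp_congr => p args; apply: neg_part_pair.
apply: pred_interp_ext => -[p|u] args /=; last first.
  by rewrite override_notin // neg_sym_pos.
have [hp|hp] := boolP (p \in H).
- by rewrite override_in ?in_pos_heads //; apply: conseq_pos.
- rewrite override_notin ?in_pos_heads //= /B override_notin //.
  by rewrite /alt_op gid_conseq_open.
Qed.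

(** By [Delta_op], J |-> [pair_interp J (stable fi D O J)] is a bijection from the fixpoints of
    [alt_op] to those of the outer operator. It preserves inclusion, as both ST and complementation
    reverse it, so least fixpoints correspond. *)
Lemma Delta_modelP (X : interp') : old_part X = O ->
  is_fp Least (fd_op (S := ext_voc D) fi (Delta D) X) X <->
  is_fp Least (alt_op fi D O) O /\ X = pair_interp O (stable fi D O O).
Proof.
move=> XO; split=> [[]|[[altO minO] defX]].
- rewrite Delta_op // XO => defX minX.
  have altO : alt_op fi D O O = O by rewrite -{3}XO -defX.
  split; last by rewrite -{1}defX altO.
  split=> // K altK p args; rewrite -{1}XO /old_part => Xp.
  have XK : sub_interp X (pair_interp K (stable fi D O K)).
    by apply: minX; rewrite Delta_op // altK.
  exact: (XK (old_sym D p)).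
- split=> [|K]; first by rewrite Delta_op // XO altO.
  rewrite Delta_op //; set J := old_part K => defK.
  have altJ : alt_op fi D O J = J := congr1 old_part defK.
  have OJ := minO _ altJ.
  rewrite -defK altJ defX => -[p|u] args /=; first exact: OJ.
  by move=> nst st; apply: nst; apply: stable_anti OJ _ _ st.
Qed.

End Translation.

(** In a model of [Delta D] the new predicates are the complements of ST(O), where O is the old
    part. They complement O exactly when ST(O) = O on the heads, and outside the heads ST(O) agrees
    with O anyway; this is the extra condition in [well_founded2P]. *)
Lemma Delta_complementary_modelP (S : vocabulary) (D : rules S)
    (I : structure (ext_voc D)) :
  fd_model (Delta D) I /\ complementary I <->
  gid_model D (restrict I) /\
  ipred I = pair_interp (ipred (restrict I)) (ipred (restrict I)).
Proof.
rewrite /fd_model /gid_model well_founded2P.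
rewrite (@Delta_modelP S _ (ifun I) D (ipred (restrict I)) (ipred I) erefl).
set O := ipred (restrict I); set st := stable _ _ _ _.
split=> [[[fpO defI] compl]|[[stO fpO] defI]].
- have stO : st = O.
    apply: pred_interp_ext => p args.
    have [hp|hp] := boolP (p \in heads D); last first.
      by rewrite /st -stable_fixed gid_conseq_open.
    have := compl p hp args; rewrite defI /=.
    by split=> h; apply: NNPP; tauto.
  by split=> //; rewrite {1}defI stO.
- split; first by rewrite stO.
  by move=> p hp args; rewrite defI.
Qed.

(** * The correspondence between models *)

Definition expand (S : vocabulary) (D : rules S) (I : structure S) :
    structure (ext_voc D) :=
  @Structure (ext_voc D) (dom I) (dom_inhabited I) (ifun I)
    (pair_interp (ipred I) (ipred I)).

Lemma restrict_expand (S : vocabulary) (D : rules S) (I : structure S) :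
  restrict (expand D I) = I.
Proof. by case: I. Qed.

Lemma expand_model (S : vocabulary) (D : rules S) (I : structure S) :
  gid_model D I -> fd_model (Delta D) (expand D I) /\ complementary (expand D I).
Proof.
by move=> mI; apply/Delta_complementary_modelP; split=> //; rewrite restrict_expand.
Qed.

Lemma expand_restrict (S : vocabulary) (D : rules S) (I : structure (ext_voc D)) :
  ipred I = pair_interp (ipred (restrict I)) (ipred (restrict I)) ->
  expand D (restrict I) = I.
Proof. by case: I => A a fi X; rewrite /expand /= => <-. Qed.

Theorem theorem3p5 (S : vocabulary) (D : rules S) :
  exists f : {I : structure S | gid_model D I} ->
             {I' : structure (ext_voc D) | fd_model (Delta D) I'},
    [/\ injective f,
        forall I, [/\ dom (sval (f I)) = dom (sval I),
                      restrict (sval (f I)) = sval I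
                    & complementary (sval (f I))]
      & forall I', complementary (sval I') -> exists I, f I = I'].
Proof.
exists (fun I => exist _ (expand D (sval I)) (proj1 (expand_model (proj2_sig I)))).
split=> [I J|I|[I' mI'] /= cI'].
(* [restrict] is a left inverse of [expand], and proofs of modelhood are equal by proof
   irrelevance. *)
- move/(congr1 (fun K => restrict (sval K))); rewrite /= !restrict_expand.
  case: I J => [I mI] [J mJ] /= eqIJ; exact: subset_eq_compat.
- split; [by []|exact: restrict_expand|].
  exact: (proj2 (expand_model (proj2_sig I))).
(* Complementarity makes [I'] the expansion of its own restriction, which is the required
   preimage. *)
- have [mI defI'] := proj1 (Delta_complementary_modelP I') (conj mI' cI').
  exists (exist _ (restrict I') mI).
  by apply: subset_eq_compat; apply: expand_restrict.
Qed.
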